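(* Suppose $\sup_n(|a_n|+|b_n|)<\infty$ and let $J$ be the infinite Jacobi matrix with parameters $(a_n)_{n\ge1},(b_n)_{n\ge1}$, a bounded self-adjoint operator on $\ell^2(\{1,2,\dots\})$. Let $E_0\in\mathbb{R}$. Then, with the convention $\operatorname{sgn}(0)=1$, the following equalities hold in $\{0,1,2,\dots\}\cup\{\infty\}$: $$\dim\operatorname{Ran}P_{(E_0,\infty)}(J)=\#\{\ell\in\{1,2,\dots\} : \operatorname{sgn}(P_{\ell-1}(E_0))\ne\operatorname{sgn}(P_\ell(E_0))\},$$ $$\dim\operatorname{Ran}P_{(-\infty,E_0)}(J)=\#\{\ell\in\{1,2,\dots\} : \operatorname{sgn}(P_{\ell-1}(E_0))=\operatorname{sgn}(P_\ell(E_0))\}.$$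
   Context: Let $a_1,a_2,\dots$ be nonzero real numbers and $b_1,b_2,\dots$ real numbers. The infinite Jacobi matrix $J$ acts by $(Ju)_n=a_nu_{n+1}+b_nu_n+a_{n-1}u_{n-1}$ for $n\ge1$, with $u_0\equiv0$. For a Borel set $I\subset\mathbb{R}$, $P_I(J)$ denotes the spectral projection of $J$ onto $I$. The polynomials $p_n(E)$, $n\ge0$, are defined by $p_{-1}\equiv0$, $p_0\equiv1$ and $a_{n+1}p_{n+1}(E)+(b_{n+1}-E)p_n(E)+a_np_{n-1}(E)=0$ for $n=0,1,2,\dots$ (the value of $a_0$ is irrelevant). Set $P_0=1$ and $P_n(E)=(a_1\cdots a_n)\,p_n(E)$, a monic polynomial of degree $n$ (not to be confused with the spectral projections $P_I(J)$). Here $\operatorname{sgn}(x)=1$ for $x\ge0$ and $\operatorname{sgn}(x)=-1$ for $x<0$. *)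

(* Defs.v *)
(* MathComp-Analysis, with complex numbers R[i] from mathcomp-real-closed. *)
From HB Require Import structures.
From mathcomp Require Import all_boot all_order all_algebra.
From mathcomp Require Import all_classical all_reals all_analysis.
From mathcomp Require Import complex.

Set Implicit Arguments.
Unset Strict Implicit.
Unset Printing Implicit Defensive.

Import Order.TTheory GRing.Theory Num.Theory.
Import numFieldNormedType.Exports.

Local Open Scope classical_set_scope.
Local Open Scope ring_scope.
Local Open Scope complex_scope.

(* An element of ell^2({1, 2, ...}) is a square-summable u : nat -> R[i] with
   u 0 = 0, so that indices are those of the mathematical text and the
   convention u_0 = 0 is part of the space. *)
Definition ell2 (R : realType) : set (nat -> R[i]) :=
  [set u : nat -> R[i] | u 0%N = 0 /\
           cvgn (series (fun k =>
             complex.Re (u k) ^+ 2 + complex.Im (u k) ^+ 2 : R))].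

(* Convergence in R[i] is componentwise; both real series converge absolutely
   when u and v are square-summable. *)
Definition inner (R : realType) (u v : nat -> R[i]) : R[i] :=
  limn (series (fun k => complex.Re (conjc (u k) * v k) : R))
  +i* limn (series (fun k => complex.Im (conjc (u k) * v k) : R)).

(* Operators on ell^2 are functions on all sequences, of which only the values
   on ell2 are ever used. *)
Definition operator (R : realType) := (nat -> R[i]) -> (nat -> R[i]).

(* Maximal number of linearly independent vectors, +oo if unbounded. *)
Definition lin_indep (R : realType) (n : nat) (v : 'I_n -> nat -> R[i]) : Prop :=
  forall c : 'I_n -> R[i],
    (forall k, \sum_(i < n) c i * v i k = 0) -> forall i, c i = 0.

Definition ell2_dim (R : realType) (S : set (nat -> R[i])) : \bar R :=
  ereal_sup [set n%:R%:E | n in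
    [set n : nat | exists2 v : 'I_n -> nat -> R[i],
                     (forall i, S (v i)) & lin_indep v]].

Definition Ran (R : realType) (T : operator R) : set (nat -> R[i]) :=
  [set T u | u in @ell2 R].

Definition orthogonal_projection (R : realType) (T : operator R) : Prop :=
  [/\ forall u, ell2 u -> ell2 (T u),
      forall (c : R[i]) u v, ell2 u -> ell2 v ->
        T (fun k => c * u k + v k) = (fun k => c * T u k + T v k),
      forall u, ell2 u -> T (T u) = T u &
      forall u v, ell2 u -> ell2 v -> inner (T u) v = inner u (T v)].

(* mu is the scalar measure A |-> <u, P(A) u> on the Borel sets of R; the inner
   product is real when P(A) is an orthogonal projection. *)
Definition scalar_measure (R : realType) (P : set R -> operator R)
    (u : nat -> R[i]) (mu : {measure set (measurableTypeR R) -> \bar R}) : Prop :=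
  forall A : set (measurableTypeR R), measurable A ->
    mu A = (complex.Re (inner u (P A u)))%:E.

(* Projection-valued measures on the Borel sets of R. Countable additivity is
   that of all the A |-> <u, P(A) u>; by polarization it is the same for all the
   A |-> <u, P(A) v>. *)
Definition resolution_of_identity (R : realType) (P : set R -> operator R) : Prop :=
  [/\ forall A : set (measurableTypeR R), measurable A ->
        orthogonal_projection (P A),
      forall u, ell2 u -> P set0 u = (fun=> 0),
      forall u, ell2 u -> P setT u = u,
      forall A B : set (measurableTypeR R), measurable A -> measurable B ->
        forall u, ell2 u -> P (A `&` B) u = P A (P B u) &
      forall u, ell2 u -> exists mu, scalar_measure P u mu].

(* P is the spectral measure of the bounded self-adjoint operator T, i.e.
   T = \int x dP(x): <u, T u> = \int x d<u, P(x) u> for all u. By the spectral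
   theorem there is exactly one such P (on Borel sets and on ell2); its value at
   a Borel set I is the spectral projection P_I(T). *)
Definition spectral_measure_of (R : realType) (T : operator R)
    (P : set R -> operator R) : Prop :=
  resolution_of_identity P /\
  forall u (mu : {measure set (measurableTypeR R) -> \bar R}),
    ell2 u -> scalar_measure P u mu ->
    mu.-integrable setT (fun x : measurableTypeR R => (x : R)%:E) /\
    inner u (T u) = (\int[mu]_x (x : R))%:C.

(* The sequences a and b are indexed from 1; a 0 and b 0 are irrelevant. *)
Definition jacobi (R : realType) (a b : nat -> R) : operator R :=
  fun u n => if n is m.+1
             then (a n)%:C * u n.+1 + (b n)%:C * u n + (a m)%:C * u m
             else 0.

Fixpoint jacobi_p (R : realType) (a b : nat -> R) (n : nat) : {poly R} :=
  if n is m.+1 then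
    (a m.+1)^-1 *: (('X - (b m.+1)%:P) * jacobi_p a b m
                    - (if m is k.+1 then a m *: jacobi_p a b k else 0))
  else 1.

Lemma jacobi_p_rec (R : realType) (a b : nat -> R) (n : nat) : a n.+1 != 0 ->
  a n.+1 *: jacobi_p a b n.+1 + ((b n.+1)%:P - 'X) * jacobi_p a b n
  + (if n is k.+1 then a n *: jacobi_p a b k else 0) = 0.
Proof.
move=> an0 /=; rewrite scalerA mulfV// scale1r.
by rewrite -['X - _]opprB mulNr addrAC subrK addNr.
Qed.

Definition jacobi_P (R : realType) (a b : nat -> R) (n : nat) : {poly R} :=
  (\prod_(1 <= k < n.+1) a k) *: jacobi_p a b n.

(* Not Num.sg, which is 0 at 0. *)
Definition sgn (R : realType) (x : R) : R := if 0 <= x then 1 else -1.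

(* Main.v *)
(* Let A = J - E0 and let w_l = (p_0(E0), ..., p_{l-1}(E0), 0, ...). Since A w_l
   is supported in {l, l+1}, the vectors w_l are orthogonal for <u, A u>, and
   <w_l, A w_l> = - a_l p_l p_{l-1} is positive exactly when P_{l-1}(E0) and
   P_l(E0) have opposite signs. Equivalently, on finitely supported vectors <u, A u>
   is a sum of squares of linear functionals L_l, weighted by signs; if
   P_l(E0) = 0 the indices l and l+1 give together one positive and one negative
   square. If L_l(u) = 0 for every l without a sign change, and u is finitely
   supported and nonzero, then <u, A u> > 0, which forces P_(E0,oo) u <> 0:
   this bounds the dimension from below. If u is in the range of P_(E0,oo) and
   L_l(u) = 0 for the finitely many l with a sign change, then <u, A u> <= 0 by
   truncation, hence u = 0: this bounds it from above. The other half-line is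
   obtained from -A. *)
Require Import Defs.
From HB Require Import structures.
From mathcomp Require Import all_boot all_order all_algebra.
From mathcomp Require Import all_classical all_reals all_analysis.
From mathcomp Require Import complex.
From mathcomp Require Import measurable_realfun finmap ring lra zify.

Set Implicit Arguments.
Unset Strict Implicit.
Unset Printing Implicit Defensive.

Import Order.TTheory GRing.Theory Num.Theory.
Import numFieldNormedType.Exports.

Local Open Scope classical_set_scope.
Local Open Scope ring_scope.

(** * Square-summable real sequences *)

Definition l2 (R : realType) (x : nat -> R) : Prop :=
  cvgn (series (fun k => x k ^+ 2)).

Section SquareSummable.
Variable R : realType.
Implicit Types x y c : nat -> R.

Lemma l2_le x y : l2 y -> (forall k, `|x k| <= `|y k|) -> l2 x.
Proof.
move=> y2 xy; apply: series_le_cvg y2 => k; rewrite ?sqr_ge0 //.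
by rewrite -[leLHS]ger0_norm ?sqr_ge0 // -[leRHS]ger0_norm ?sqr_ge0 // !normrX lerXn2r ?nnegrE.
Qed.

Lemma l2Z (C : R) x : l2 x -> l2 (fun k => C * x k).
Proof.
move=> x2; rewrite /l2.
have -> : (fun k => (C * x k) ^+ 2) = C ^+ 2 *: (fun k => x k ^+ 2).
  by apply/funext => k; rewrite /= exprMn.
exact: is_cvg_seriesZ.
Qed.

Lemma l2_bounded c x (C : R) : (forall k, `|c k| <= C) -> l2 x -> l2 (fun k => c k * x k).
Proof.
move=> cC x2; apply: (l2_le (l2Z (C := C) x2)) => k.
by rewrite !normrM ler_wpM2r // (le_trans (cC k)) // ler_norm.
Qed.

Lemma l2D x y : l2 x -> l2 y -> l2 (fun k => x k + y k).
Proof.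
move=> x2 y2; have xy := is_cvg_seriesD x2 y2.
apply: (series_le_cvg _ _ _ (is_cvg_seriesZ (k := 2) xy)) => k /=; rewrite ?sqr_ge0 //.
  by rewrite mulr_ge0 // addr_ge0 ?sqr_ge0.
rewrite -subr_ge0; have -> : 2 * (x k ^+ 2 + y k ^+ 2) - (x k + y k) ^+ 2 = (x k - y k) ^+ 2.
  by ring.
exact: sqr_ge0.
Qed.

Lemma l2S x : l2 x -> l2 (fun k => x k.+1).
Proof.
move=> x2; rewrite /l2.
have -> : series (fun k => x k.+1 ^+ 2) =
          (fun n => series (fun k => x k ^+ 2) n.+1 - x 0%N ^+ 2).
  by apply/funext => n; rewrite /series /= big_nat_recl //= addrC addKr.
apply: is_cvgB; last exact: is_cvg_cst.
by apply/cvg_ex; exists (limn (series (fun k => x k ^+ 2))); rewrite (cvg_shiftS (series _)).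
Qed.

Lemma l2_pred x : l2 x -> l2 (fun k => x k.-1).
Proof.
move=> x2; apply/cvg_ex; exists (x 0%N ^+ 2 + limn (series (fun k => x k ^+ 2))).
rewrite -(cvg_shiftS (series _)) /=.
have -> : (fun n => series (fun k => x k.-1 ^+ 2) n.+1) =
          (fun n => x 0%N ^+ 2 + series (fun k => x k ^+ 2) n).
  by apply/funext => n; rewrite /series /= big_nat_recl.
by apply: cvgD => //; exact: cvg_cst.
Qed.

Lemma l2_finite_support x N : (forall k, (N < k)%N -> x k = 0) -> l2 x.
Proof.
move=> xN; apply/cvg_ex; exists (series (fun k => x k ^+ 2) N.+1).
apply: cvg_near_cst; exists N.+1 => // n /= Nn.
rewrite /series /= (big_cat_nat _ (n := N.+1)) //= [X in _ + X = _]big_nat.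
by rewrite [X in _ + X = _]big1 ?addr0 // => k /andP[/xN-> _]; rewrite expr0n.
Qed.

Lemma l2_mul x y : l2 x -> l2 y -> cvgn (series (fun k => x k * y k)).
Proof.
move=> x2 y2; apply: normed_cvg; apply: series_le_cvg (is_cvg_seriesD x2 y2) => k //=.
  by rewrite addr_ge0 ?sqr_ge0.
rewrite ler_norml !fctE; have := sqr_ge0 (x k + y k); have := sqr_ge0 (x k - y k).
by move=> ? ?; apply/andP; split; nra.
Qed.

Lemma l2_cvg0 x : l2 x -> x k @[k --> \oo] --> (0 : R).
Proof.
move=> /cvg_series_cvg_0 x2; apply/cvgr0Pnorm_lt => e e0.
move/cvgr0Pnorm_lt: x2 => /(_ (e ^+ 2)); rewrite exprn_gt0 // => /(_ isT).
apply: filterS => k; rewrite normrX => H.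
by rewrite -(ltr_pXn2r (n := 2)) ?nnegrE // ltW.
Qed.
End SquareSummable.

(** * First moments of a finite measure and open half-lines *)

(** The factor [s] selects the side of [E0]: [s = 1] is used for the upper half-line and [s = -1]
    for the lower one, so that a single argument treats both. *)
Definition halfline (R : realType) (s E0 : R) : set (measurableTypeR R) :=
  [set x : R | 0 < s * (x - E0)].

Lemma measurable_halfline (R : realType) (s E0 : R) : measurable (halfline s E0).
Proof.
pose g (x : measurableTypeR R) : R := s * ((x : R) - E0).
have mg : measurable_fun setT g by apply: measurable_funM => //; exact: measurable_funB.
have -> : halfline s E0 = g @^-1` `]0, +oo[.
  by apply/seteqP; split => x; rewrite /halfline /= in_itv /= andbT.
by rewrite -[_ @^-1` _]setTI; apply: mg.
Qed.

Section HalfLine.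
Variables (R : realType) (mu : {measure set (measurableTypeR R) -> \bar R}).
Variables (s E0 m : R).
Hypothesis mu_id : mu.-integrable setT (fun x : measurableTypeR R => (x : R)%:E).
Hypothesis muT : mu setT = m%:E.
Let I := halfline s E0.
Let g (x : measurableTypeR R) : R := s * ((x : R) - E0).

Let int_cst : mu.-integrable setT (fun _ : measurableTypeR R => E0%:E).
Proof.
apply/integrableP; split; first exact: measurable_cst.
by rewrite integral_cst //= muT -EFinM ltry.
Qed.

Let int_g : mu.-integrable setT (EFin \o g).
Proof.
by have := integrableZl measurableT s (integrableB measurableT mu_id int_cst).
Qed.

Let Rint_g : \int[mu]_x g x = s * (\int[mu]_x (x : R) - E0 * m).
Proof.
have int_sub : mu.-integrable setT (EFin \o (fun x : measurableTypeR R => (x : R) - E0)).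
  by have := integrableB measurableT mu_id int_cst.
rewrite /g (RintegralZl s measurableT int_sub) (RintegralB measurableT mu_id int_cst).
by rewrite Rintegral_cst // muT.
Qed.

Let mI : measurable I := measurable_halfline s E0.

Let Rint_null A : measurable A -> mu A = 0%E -> \int[mu]_(x in A) g x = 0.
Proof.
move=> mA muA.
have iA : mu.-integrable A (EFin \o g) by apply: integrableS int_g.
have mA' := measurable_int _ iA.
apply/eqP; rewrite -normr_le0; apply: le_trans (le_normr_Rintegral mA iA) _.
rewrite /Rintegral (_ : (fun x => `|g x|%:E) = (fun x => `|(EFin \o g) x|%E)) //.
by rewrite integral_abs_eq0.
Qed.

Let Rint_split : \int[mu]_x g x = \int[mu]_(x in I) g x + \int[mu]_(x in ~` I) g x.
Proof.
rewrite -Rintegral_setU ?setUv //; first exact: measurableC.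
exact/disj_setPCl.
Qed.

(** Only the complement of [I] contributes to the integral of [s * (x - E0)], and the integrand is
    nonpositive there. *)
Lemma moment_le0 : mu I = 0%E -> s * (\int[mu]_x (x : R) - E0 * m) <= 0.
Proof.
move=> muI; rewrite -Rint_g Rint_split Rint_null // add0r.
have iCI : mu.-integrable (~` I) (EFin \o g).
  by apply: integrableS int_g => //; exact: measurableC.
rewrite -oppr_ge0 -mulN1r -(RintegralZl _ (measurableC mI) iCI).
by apply: Rintegral_ge0 => x /negP; rewrite -leNgt mulN1r oppr_ge0.
Qed.

Lemma moment_gt0 : mu (~` I) = 0%E -> 0 < m -> 0 < s * (\int[mu]_x (x : R) - E0 * m).
Proof.
move=> muCI m0; rewrite -Rint_g Rint_split (Rint_null (measurableC mI)) // addr0.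
have iI : mu.-integrable I (EFin \o g) by apply: integrableS int_g.
rewrite lt_neqAle Rintegral_ge0 ?andbT => [|x /ltW //].
apply/eqP => /esym intI.
(* The integrand is positive on [I], so a zero integral makes [I] null; with the null complement
   this gives total mass 0, against [0 < m]. *)
have /(ae_eq_integral_abs mu mI (measurable_int _ iI)) [B [mB muB IB]] :
    (\int[mu]_(x in I) `|(EFin \o g) x| = 0)%E.
  rewrite (eq_integral (EFin \o g)) => [|x]; last first.
    by rewrite in_setE /I /halfline /= => /ltW gx; rewrite ger0_norm.
  by rewrite -[LHS]fineK ?integrable_fin_num //; congr EFin.
have muI : mu I = 0%E.
  apply: subset_measure0 muB => // x Ix; apply: IB => /= /(_ Ix) [] gx.
  by move: Ix; rewrite /I /halfline /= -/(g x) gx ltxx.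
have : mu setT = 0%E by rewrite -(setUv I) measureU0 //; exact: measurableC.
by rewrite muT => -[] m00; rewrite m00 ltxx in m0.
Qed.
End HalfLine.

(** * A tridiagonal form as a signed sum of squares *)

Section Diagonalization.
Variables (R : realType) (a b p eps : nat -> R).
Hypothesis a0 : a 0%N = 0.
Hypothesis aS : forall n, a n.+1 != 0.
Hypothesis p0 : p 0%N = 1.
Hypothesis pS : forall n, a n.+1 * p n.+1 + b n.+1 * p n + a n * p n.-1 = 0.
(** [eps l] is the sign of square number [l]. Away from the zeros of [p] it is prescribed by
    [eps_gt0]; at a zero only the alternation [epsN] is imposed. *)
Hypothesis eps2 : forall n, eps n ^+ 2 = 1.
Hypothesis epsN : forall n, p n.+1 = 0 -> eps n.+2 = - eps n.+1.
Hypothesis eps_gt0 : forall n, p n != 0 -> p n.+1 != 0 ->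
  0 < eps n.+1 * - (a n.+1 * p n.+1 * p n).

Definition tri (y : nat -> R) n := a n * y n.+1 + b n * y n + a n.-1 * y n.-1.

(* When [p l = 0], the functionals number [l] and [l + 1] replace the two equal
   ones [a l * (p l.-1 * y l.+1)] and [- a l.+1 * (p l.+1 * y l.+1)]: they span a
   hyperbolic plane, on which the form has one square of each sign. *)
Definition diag_form l (y : nat -> R) : R :=
  if p l == 0 then a l.+1 * y l.+2 + a l * y l + (eps l + b l.+1) / 2 * y l.+1
  else if p l.-1 == 0 then a l * y l.+1 + a l.-1 * y l.-1 + (eps l + b l) / 2 * y l
  else a l * (p l.-1 * y l.+1 - p l * y l).

(** In the last case of [diag_form], [diag_form l y] is <y, A w_l> and this weight is <w_l, A w_l>,
    so the square divided by the weight is the usual term of an expansion in an orthogonal basis.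
    Next to a zero of [p] the weight is just the sign. *)
Definition diag_coef l : R :=
  if (p l == 0) || (p l.-1 == 0) then eps l else - (a l * p l * p l.-1).

(** Since no [a n.+1] vanishes, two consecutive zeros would propagate down the recurrence to
    [p 0 = 1]. *)
Lemma p_consecutive n : p n = 0 -> p n.+1 != 0.
Proof.
elim: n => [|n IHn] pn0; first by move: pn0; rewrite p0 => /eqP; rewrite oner_eq0.
apply/eqP => pn2; have := pS n.+1; rewrite pn2 pn0 !mulr0 !add0r /=.
by move/eqP; rewrite mulf_eq0 (negPf (aS n)) /= => /eqP /IHn; rewrite pn0 eqxx.
Qed.

(** The zeros of [p] are isolated, so consecutive indices with [p n != 0] are one or two apart. A
    step of two passes over a zero and takes in a whole hyperbolic pair. *)
Lemma nonzero_ind (Q : nat -> Prop) : Q 0%N ->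
  (forall n, p n != 0 -> p n.+1 != 0 -> Q n -> Q n.+1) ->
  (forall n, p n != 0 -> p n.+1 = 0 -> p n.+2 != 0 -> Q n -> Q n.+2) ->
  forall n, p n != 0 -> Q n.
Proof.
move=> Q0 Q1 Q2 n; have [m] := ubnP n; elim: m n => // m IHm [|[|n]] // lt_nm pn0.
  by apply: Q1 => //; rewrite p0 oner_neq0.
have [pn1|pn1] := eqVneq (p n.+1) 0; last by apply: Q1 => //; apply: IHm.
have pn : p n != 0.
  by apply: contraTneq isT => /p_consecutive; rewrite pn1 eqxx.
by apply: Q2 => //; apply: IHm => //; apply: ltnW.
Qed.

Lemma diag_coef_gt0 l : 0 < eps l.+1 * diag_coef l.+1.
Proof.
rewrite /diag_coef /=; case: ifPn => [_|]; first by rewrite -expr2 eps2 ltr01.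
by rewrite negb_or => /andP[? ?]; apply: eps_gt0.
Qed.

(** The boundary term is what remains after completing squares up to [N]; each induction step
    absorbs one new square, or one pair. It vanishes as soon as [y N.+1 = 0]. *)
Lemma sum_diag y N : p N != 0 ->
  \sum_(1 <= l < N.+1) diag_form l y ^+ 2 / diag_coef l =
  \sum_(1 <= l < N.+1) y l * tri y l
  + a N * (y N * y N.+1 - p N.-1 / p N * y N.+1 ^+ 2).
Proof.
move: N; apply: nonzero_ind => [|n pn pn1 IHn|n pn pn1 pn2 IHn].
- by rewrite !big_nil a0 mul0r addr0.
- rewrite !(big_nat_recr n.+1) //= IHn /diag_form /diag_coef /tri /= (negPf pn) (negPf pn1) /=.
  have := pS n; have := aS n.
  move: (\sum_(_ <= _ < _) _) => S an1 E.
  have -> : b n.+1 = - (a n.+1 * p n.+1 + a n * p n.-1) / p n.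
    by apply: (mulIf pn); rewrite divfK //; move: E => /eqP; lra.
  by field; rewrite pn pn1 an1.
- rewrite !(big_nat_recr n.+2) ?(big_nat_recr n.+1) //= IHn.
  rewrite /diag_form /diag_coef /tri /= pn1 eqxx (negPf pn) (negPf pn2) /=.
  have := pS n; have := pS n.+1; rewrite pn1 /= (epsN pn1).
  have := eps2 n.+1; move: (eps n.+1) => e e2 E2 E1.
  move: (\sum_(_ <= _ < _) _) => S.
  have e0 : e != 0 by apply: contra_eq_neq e2 => ->; rewrite expr0n /= eq_sym oner_neq0.
  have -> : b n.+1 = - (a n * p n.-1) / p n.
    by apply: (mulIf pn); rewrite divfK //; move: E1; rewrite mulr0; lra.
  have -> x : x / e = x * e by rewrite -[in LHS](mulr1 x) -e2; field.
  have -> x : x / - e = - x * e by rewrite -[in LHS](mulr1 x) -e2; field.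
  (* Difference of the two squares of a hyperbolic pair, with [e ^+ 2 = 1]: the half-sums cancel and
     leave exactly the terms of the form that involve [z]. *)
  have key x z c : (x + (e + c) / 2 * z) ^+ 2 * e + - (x + (- e + c) / 2 * z) ^+ 2 * e
      = z * (2 * x + c * z).
    by transitivity (e ^+ 2 * (z * (2 * x + c * z))); [field | rewrite e2 mul1r].
  by rewrite -[LHS]addrA key; field; rewrite pn pn2.
Qed.

(** The coordinates are killed from the top: when [y N.+1 = 0], the last form is a nonzero multiple
    of [y N], or the last two forms determine the last two coordinates. *)
Lemma diag_form_inj y N : p N != 0 -> y 0%N = 0 -> (forall k, (N < k)%N -> y k = 0) ->
  (forall l, (0 < l <= N)%N -> diag_form l y = 0) -> forall k, y k = 0.
Proof.
move=> pN y0; move: N pN; apply: nonzero_ind => [|n pn pn1 IHn|n pn pn1 pn2 IHn] yN dN.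
- by case=> // k; apply: yN.
- apply: IHn => [k|l /andP[l0 ln]]; last by apply: dN; rewrite l0 leqW.
  rewrite leq_eqVlt => /predU1P[<-|/yN //].
  have := dN n.+1; rewrite leqnn /diag_form /= (negPf pn) (negPf pn1) yN // => /(_ isT).
  by move/eqP; rewrite mulr0 add0r mulrN oppr_eq0 !mulf_eq0 (negPf (aS n)) (negPf pn1) => /eqP.
- have := dN n.+1; have := dN n.+2; rewrite !leqnn leqnSn /diag_form /= pn1 eqxx (negPf pn2).
  rewrite (yN n.+3) // (epsN pn1) => /(_ isT) E2 /(_ isT) E1.
  have e0 : eps n.+1 != 0.
    by apply: contra_eq_neq (eps2 n.+1) => ->; rewrite expr0n /= eq_sym oner_neq0.
  (* The two forms of the pair differ by [eps n.+1 * y n.+2]. *)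
  have y2 : y n.+2 = 0.
    apply/eqP; rewrite -(mulrI_eq0 _ (mulfI e0)); apply/eqP.
    move: E1 E2; lra.
  have y1 : y n.+1 = 0.
    apply/eqP; rewrite -(mulrI_eq0 _ (mulfI (aS n))); apply/eqP.
    move: E2; rewrite y2; lra.
  apply: IHn => [k|l /andP[l0 ln]]; last by apply: dN; rewrite l0 ltnW // ltnW.
  by rewrite leq_eqVlt => /predU1P[<- //|]; rewrite leq_eqVlt => /predU1P[<- //|/yN].
Qed.

Lemma diag_form_sum (T : Type) (r : seq T) l (c : T -> R) (y : T -> nat -> R) :
  diag_form l (fun k => \sum_(i <- r) c i * y i k) = \sum_(i <- r) c i * diag_form l (y i).
Proof.
rewrite /diag_form; case: ifP => _; last case: ifP => _;
  rewrite !mulr_sumr -?sumrB -?big_split /= ?mulr_sumr -?big_split /=;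
  apply: eq_bigr => i _; ring.
Qed.

Lemma diag_form_lin l (c e : R) (x y z : nat -> R) :
  diag_form l (fun k => c * x k + e * y k + z k) =
  c * diag_form l x + e * diag_form l y + diag_form l z.
Proof. rewrite /diag_form; case: ifP => _; last case: ifP => _; ring. Qed.

Lemma diag_form0 l : diag_form l (fun=> 0) = 0.
Proof. by rewrite /diag_form !mulr0 subr0 !addr0 mulr0 !if_same. Qed.

(** By [diag_form_inj] the first [N] forms are independent on the [N]-dimensional space of sequences
    supported in {1, ..., N}; the rows of the inverse matrix are the dual basis. *)
Lemma dual_basis N : p N != 0 -> exists f : nat -> nat -> R,
  forall l, (0 < l <= N)%N -> [/\ f l 0%N = 0, forall k, (N < k)%N -> f l k = 0 &
    forall m, (0 < m <= N)%N -> diag_form m (f l) = (m == l)%:R].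
Proof.
move=> pN.
(* Column [i] of the row vector becomes the coordinate of index [i + 1]; the coordinate 0 and those
   beyond [N] are 0. *)
pose ext (x : 'rV[R]_N) k := if k is k'.+1 then
  (if insub k' is Some i then x ord0 i else 0) else 0.
pose M : 'M[R]_N := \matrix_(i, j) diag_form j.+1 (ext (delta_mx ord0 i)).
have ext_sum x k : ext x k = \sum_i x ord0 i * ext (delta_mx ord0 i) k.
  case: k => [|k] /=; first by rewrite big1 // => i _; rewrite mulr0.
  case: insubP => [i _ _|_]; last by rewrite big1 // => i _; rewrite mulr0.
  rewrite (bigD1 i) //= mxE !eqxx mulr1 big1 ?addr0 // => j ji.
  by rewrite mxE [i == j]eq_sym (negPf ji) mulr0.
have MP x j : (x *m M) ord0 j = diag_form j.+1 (ext x).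
  rewrite mxE (_ : ext x = fun k => \sum_i x ord0 i * ext (delta_mx ord0 i) k); last first.
    by apply/funext => k; rewrite -ext_sum.
  by rewrite diag_form_sum; under eq_bigr do rewrite mxE.
have extN x k : (N < k)%N -> ext x k = 0.
  by case: k => //= k; rewrite ltnS => Nk; rewrite insubF // ltnNge Nk.
have unitM : M \in unitmx.
  rewrite unitmxE unitfE; apply/det0P => -[x x0 xM].
  have ext0 : forall k, ext x k = 0.
    apply: (diag_form_inj pN) => // [k|[|l] // lN]; first exact: extN.
    by have := MP x (Ordinal lN); rewrite xM mxE.
  case/eqP: x0; apply/rowP => i; rewrite mxE.
  by have := ext0 i.+1; rewrite /= valK.
exists (fun l => if l is l'.+1 then
  (if insub l' is Some i then ext (row i (invmx M)) else fun=> 0) else fun=> 0).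
move=> [|l] //= lN; rewrite insubT /=; split => // [k|[|m] // mN]; first exact: extN.
have := MP (row (Ordinal lN) (invmx M)) (Ordinal mN) => /= <-.
by rewrite -row_mul mulVmx // !mxE -val_eqE /= eqSS eq_sym.
Qed.

(** * The sign of the form on square-summable sequences *)

Variable C : R.
Hypothesis aC : forall n, `|a n| <= C.
Hypothesis bC : forall n, `|b n| <= C.

Lemma l2_tri y : l2 y -> l2 (tri y).
Proof.
move=> y2; apply: l2D; first apply: l2D.
- exact: (l2_bounded aC (l2S y2)).
- exact: (l2_bounded bC y2).
- exact: (l2_pred (l2_bounded aC y2)).
Qed.

Definition tri_form (y : nat -> R) : R := limn (series (fun k => y k * tri y k)).

Lemma is_cvg_tri_form y : l2 y -> cvgn (series (fun k => y k * tri y k)).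
Proof. by move=> y2; apply: l2_mul => //; exact: l2_tri. Qed.

Lemma tri_form_fin y N : p N != 0 -> y 0%N = 0 -> (forall k, (N < k)%N -> y k = 0) ->
  tri_form y = \sum_(1 <= l < N.+1) diag_form l y ^+ 2 / diag_coef l.
Proof.
move=> pN y0 yN; rewrite sum_diag // (yN N.+1) // expr0n !mulr0 subr0 mulr0 addr0.
apply: lim_near_cst => //; exists N.+1 => // n /= Nn.
rewrite /series /= (big_cat_nat _ (n := N.+1)) //= big_ltn // y0 mul0r add0r.
by rewrite [X in _ + X = _]big_nat [X in _ + X = _]big1 ?addr0 // => k /andP[/yN-> _]; rewrite mul0r.
Qed.

(** [eps l.+1] has square 1 and the sign of [diag_coef l.+1], so it can be exchanged for the
    weight. *)
Lemma diag_coefV_gt0 s l : 0 < s * eps l.+1 -> 0 < s / diag_coef l.+1.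
Proof.
move=> s0; have d0 := diag_coef_gt0 l.
have {d0 s0} := mulr_gt0 s0 d0; rewrite mulrA -(mulrA s) -expr2 eps2 mulr1 => sd.
have d0 : diag_coef l.+1 != 0 by apply: contraTneq sd => ->; rewrite mulr0 ltxx.
have -> : s / diag_coef l.+1 = s * diag_coef l.+1 * (diag_coef l.+1)^-1 ^+ 2 by field.
by rewrite mulr_gt0 // exprn_even_gt0 //= invr_neq0.
Qed.

(** The surviving terms are all nonnegative. If their sum is also nonpositive, every form vanishes
    and [diag_form_inj] applies. *)
Lemma tri_form_ge0 s y N : p N != 0 -> y 0%N = 0 -> (forall k, (N < k)%N -> y k = 0) ->
  (forall l, (0 < l)%N -> ~~ (0 < s * eps l) -> (l <= N)%N -> diag_form l y = 0) ->
  0 <= s * tri_form y /\ (s * tri_form y <= 0 -> forall k, y k = 0).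
Proof.
move=> pN y0 yN Ly; rewrite (tri_form_fin pN) // mulr_sumr.
have term_ge0 l : (0 < l <= N)%N -> 0 <= s * (diag_form l y ^+ 2 / diag_coef l).
  case: l => // l /= lN; have [s_gt0|s_le0] := boolP (0 < s * eps l.+1); last first.
    by rewrite Ly // expr0n mul0r mulr0.
  by rewrite mulrCA mulr_ge0 ?sqr_ge0 // ltW // diag_coefV_gt0.
have sum_ge0 : 0 <= \sum_(1 <= l < N.+1) s * (diag_form l y ^+ 2 / diag_coef l).
  by rewrite big_nat sumr_ge0 // => l; rewrite ltnS => /term_ge0.
split=> // sum_le0; apply: (diag_form_inj pN) => // -[//|l] lN.
have [s_gt0|s_le0] := boolP (0 < s * eps l.+1); last by rewrite Ly.
have /eqP : \sum_(1 <= l < N.+1) s * (diag_form l y ^+ 2 / diag_coef l) = 0.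
  by apply/eqP; rewrite eq_le sum_le0.
rewrite big_nat_cond psumr_eq0 => [|k /andP[]]; last first.
  by rewrite ltnS => /term_ge0.
move=> /allP/(_ l.+1); rewrite mem_index_iota !ltnS lN /= => /(_ isT).
rewrite mulrCA mulf_eq0 expf_eq0 /= => /orP[/eqP//|].
by rewrite gt_eqF // diag_coefV_gt0.
Qed.

(** Among the rows up to [n], only the last one involves [y n.+1], so the cut removes a single
    coupling term. *)
Lemma sum_tri_truncate y n : let z k := if (k <= n)%N then y k else 0 in
  \sum_(1 <= l < n.+1) z l * tri z l =
  \sum_(1 <= l < n.+1) y l * tri y l - a n * (y n * y n.+1).
Proof.
case: n => [|n] z; first by rewrite !big_nil a0 mul0r subr0.
have zE k : (k <= n.+1)%N -> z k = y k by rewrite /z => ->.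
have zS : z n.+2 = 0 by rewrite /z ltnn.
rewrite !(big_nat_recr n.+1) //= (eq_big_nat _ _ (F2 := fun l => y l * tri y l)).
  rewrite /tri zS !zE //=; ring.
by case=> // l /andP[_ ln]; rewrite /tri /= !zE //; lia.
Qed.

(* A finite truncation of [y] at [N] changes [diag_form l] only for [l >= N - 1],
   so the finitely many positive squares still vanish. *)
Lemma tri_form_le0 s y K : y 0%N = 0 -> l2 y ->
  (forall l, (0 < l)%N -> 0 < s * eps l -> (l <= K)%N) ->
  (forall l, (0 < l)%N -> 0 < s * eps l -> diag_form l y = 0) ->
  s * tri_form y <= 0.
Proof.
move=> y0 y2 epsK Ly; rewrite leNgt; apply/negP => form_gt0.
(* By [sum_tri_truncate] the bracket is the form of the truncation of [y] at [N]. The coupling term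
   tends to 0, so these forms converge to [tri_form y] and inherit its sign. *)
have eventually_pos : \forall N \near \oo,
    0 < s * (series (fun k => y k * tri y k) N.+1 - a N * (y N * y N.+1)).
  have lim1 : s * (series (fun k => y k * tri y k) N.+1 - a N * (y N * y N.+1))
      @[N --> \oo] --> s * (tri_form y - 0).
    apply: cvgMr; apply: cvgB.
      by rewrite (cvg_shiftS (series _)); exact: is_cvg_tri_form.
    have -> : (fun N => a N * (y N * y N.+1)) = (fun N => (a N * y N) * y N.+1).
      by apply/funext => N; rewrite mulrA.
    have yS : y k.+1 @[k --> \oo] --> (0 : R) := l2_cvg0 (l2S y2).
    rewrite -[X in _ --> X](mulr0 (0 : R)). exact: (cvgM (l2_cvg0 (l2_bounded aC y2)) yS).
  by rewrite subr0 in lim1; exact: (cvgr_gt _ lim1).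
have [N0 _ N0P] := eventually_pos.
(* [diag_form l] reads coordinates up to [l.+2], hence the bound [K.+2]; of two consecutive indices
   at least one is not a zero of [p]. *)
have [N pN NP] : exists2 N, p N != 0 & (maxn N0 K.+2 <= N)%N.
  have [/p_consecutive pN|pN] := eqVneq (p (maxn N0 K.+2)) 0.
    by exists (maxn N0 K.+2).+1.
  by exists (maxn N0 K.+2).
move: NP; rewrite geq_max => /andP[N0N KN].
have := N0P N N0N; rewrite /= ltNge => /negP; apply.
pose z k := if (k <= N)%N then y k else 0.
have zE k : (k <= N)%N -> z k = y k by rewrite /z => ->.
have zS : z N.+1 = 0 by rewrite /z ltnn.
have -> : series (fun k => y k * tri y k) N.+1 - a N * (y N * y N.+1)
    = \sum_(1 <= l < N.+1) z l * tri z l.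
  by rewrite sum_tri_truncate /series /= big_ltn // y0 mul0r add0r.
have := sum_diag z pN; rewrite zS expr0n !mulr0 subr0 mulr0 addr0 => <-.
rewrite mulr_sumr big_nat; apply: sumr_le0 => -[//|l]; rewrite !ltnS /= => lN.
have [s_gt0|s_le0] := boolP (0 < s * eps l.+1).
  have lK := epsK l.+1 isT s_gt0.
  suff -> : diag_form l.+1 z = diag_form l.+1 y.
    by rewrite Ly // expr0n mul0r mulr0.
  by rewrite /diag_form !zE //; lia.
(* For [s] nonzero, [s * eps l.+1] is then negative, and so is [s] over the weight. *)
have [s0|s_neq0] := eqVneq s 0; first by rewrite s0 mul0r.
rewrite mulrCA mulr_ge0_le0 ?sqr_ge0 // -oppr_ge0 -mulNr ltW //.
apply: diag_coefV_gt0; rewrite mulNr oppr_gt0 lt_neqAle leNgt s_le0 andbT.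
rewrite mulf_neq0 //; apply: contra_eq_neq (eps2 l.+1) => ->.
by rewrite expr0n /= eq_sym oner_neq0.
Qed.
End Diagonalization.

(** * Complex sequences through their real and imaginary parts *)

Section Ell2.
Variable R : realType.
Implicit Types u v : nat -> R[i].

Definition re u k : R := complex.Re (u k).
Definition im u k : R := complex.Im (u k).

Lemma ell2P u : ell2 u <-> [/\ u 0%N = 0, l2 (re u) & l2 (im u)].
Proof.
split=> [[u0 u2]|[u0 re2 im2]]; last by split=> //; exact: (is_cvg_seriesD re2 im2).
by split=> //; apply: series_le_cvg u2 => k; rewrite ?addr_ge0 ?sqr_ge0 // ?lerDl ?lerDr ?sqr_ge0.
Qed.

Lemma re_lin (c : R[i]) u v k : re (fun k => c * u k + v k) k =
  complex.Re c * re u k + - complex.Im c * im u k + re v k.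
Proof. by rewrite /re /im mulNr; case: c (u k) (v k) => [? ?] [? ?] [? ?]. Qed.

Lemma im_lin (c : R[i]) u v k : im (fun k => c * u k + v k) k =
  complex.Re c * im u k + complex.Im c * re u k + im v k.
Proof. by rewrite /re /im; case: c (u k) (v k) => [? ?] [? ?] [? ?]. Qed.

Lemma ell2_lin (c : R[i]) u v : ell2 u -> ell2 v -> ell2 (fun k => c * u k + v k).
Proof.
move=> /ell2P[u0 reu imu] /ell2P[v0 rev imv]; apply/ell2P; split.
- by rewrite u0 v0 mulr0 addr0.
- rewrite (funext (re_lin c u v)).
  exact: (l2D (l2D (l2Z reu) (l2Z imu)) rev).
- rewrite (funext (im_lin c u v)).
  exact: (l2D (l2D (l2Z imu) (l2Z reu)) imv).
Qed.

Lemma ell2_0 : ell2 (fun=> 0 : R[i]).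
Proof.
split=> //; rewrite (_ : series _ = fun=> 0); first exact: is_cvg_cst.
by apply/funext => n; rewrite /series /= big1 // => k _; rewrite !expr0n addr0.
Qed.

Lemma inner_0 u : inner u (fun=> 0) = 0.
Proof.
rewrite /inner; have lim0 (f : nat -> R) : f =1 (fun=> 0) -> limn (series f) = 0.
  move=> f0; rewrite (_ : series f = fun=> 0) ?lim_cst //.
  by apply/funext => n; rewrite /series /= big1.
by rewrite !lim0 // => k; rewrite mulr0.
Qed.

Lemma Re_innerE u : complex.Re (inner u u) = limn (series (fun k => re u k ^+ 2 + im u k ^+ 2)).
Proof.
congr (limn (series _)); apply/funext => k; rewrite /re /im.
by case: (u k) => x y /=; ring.
Qed.

Lemma Re_inner_gt0 u k : ell2 u -> u k != 0 -> 0 < complex.Re (inner u u).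
Proof.
move=> u2 uk; rewrite Re_innerE.
set f := (fun _ : nat => _); have f_ge0 j : 0 <= f j by rewrite addr_ge0 ?sqr_ge0.
have : series f k.+1 <= limn (series f).
  apply: (nondecreasing_cvgn_le _ (proj2 u2)); apply/nondecreasing_series => j _ _.
  exact: f_ge0.
apply: lt_le_trans; rewrite /series /= big_nat_recr //= ltr_wpDl ?sumr_ge0 //.
rewrite lt_neqAle f_ge0 andbT eq_sym /f paddr_eq0 ?sqr_ge0 // !sqrf_eq0.
by apply: contra uk => /andP[/eqP xk /eqP yk]; rewrite eq_complex /= -/(re u k) -/(im u k) xk yk !eqxx.
Qed.

Lemma ell2_sum (T : Type) (r : seq T) (c : T -> R[i]) (v : T -> nat -> R[i]) :
  (forall i, ell2 (v i)) -> ell2 (fun k => \sum_(i <- r) c i * v i k).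
Proof.
move=> v2; elim: r => [|i r IHr].
  by under eq_fun do rewrite big_nil; exact: ell2_0.
by under eq_fun do rewrite big_cons; apply: ell2_lin.
Qed.

Lemma projection_sum (T : Type) (r : seq T) (c : T -> R[i]) (v : T -> nat -> R[i]) Q :
  orthogonal_projection Q -> (forall i, ell2 (v i)) ->
  Q (fun k => \sum_(i <- r) c i * v i k) = (fun k => \sum_(i <- r) c i * Q (v i) k).
Proof.
case=> _ Qlin _ _ v2; elim: r => [|i r IHr].
  under eq_fun do rewrite big_nil; under [RHS]eq_fun do rewrite big_nil.
  (* Linearity is available in the form [c * u + v]; writing 0 as (-1) 0 + 0 gives Q 0 = - Q 0 + Q 0
     = 0. *)
  have := Qlin (-1) _ _ ell2_0 ell2_0.
  under eq_fun do rewrite mulr0 addr0.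
  by move=> ->; apply/funext => k; rewrite mulN1r addNr.
under eq_fun do rewrite big_cons; under [RHS]eq_fun do rewrite big_cons.
by rewrite Qlin ?IHr //; exact: ell2_sum.
Qed.

End Ell2.

(** * Dimension as the cardinality of an index set *)

Section Dimension.
Variable R : realType.

(** For infinite [A] the lower bounds over arbitrarily large finite subsets already give infinity,
    so the upper bound is asked only for finite [A]. *)
Lemma ell2_dim_counting (S : set (nat -> R[i])) (A : set nat) :
  (forall F : {fset nat}, [set` F] `<=` A ->
     exists2 v : 'I_(#|` F|) -> nat -> R[i], (forall i, S (v i)) & lin_indep v) ->
  (forall F : {fset nat}, A = [set` F] -> forall n (v : 'I_n -> nat -> R[i]),
     (forall i, S (v i)) -> lin_indep v -> (n <= #|` F|)%N) ->
  ell2_dim S = counting A.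
Proof.
move=> lower upper; rewrite /counting; case: asboolP => [finA|infA]; last first.
  apply/eqyP => r r0; have [F FA Fr] := infinite_set_fset (Num.bound r) infA.
  have [v vS vI] := lower _ FA.
  apply: (@le_trans _ _ (#|` F|%:R)%:E); last by apply: ereal_sup_ubound; exists #|` F| => //; exists v.
  by rewrite lee_fin (le_trans (ltW (archi_boundP (ltW r0)))) // ler_nat.
apply: le_anti; apply/andP; split.
  apply: ge_ereal_sup => _ [n [v vS vI] <-]; rewrite lee_fin ler_nat.
  by apply: upper vS vI; rewrite fset_setK.
apply: ereal_sup_ubound; exists #|` fset_set A| => //.
by have [|v vS vI] := lower (fset_set A); [rewrite fset_setK | exists v].
Qed.

End Dimension.

(** * The quadratic form of J - E0 *)

Section JacobiForm.
Variables (R : realType) (a b : nat -> R) (C E0 : R).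
Hypothesis abC : forall n, (0 < n)%N -> `|a n| + `|b n| <= C.

(** The value 0 at index 0 provides the hypothesis [a 0 = 0] of the diagonalization and keeps the
    bound valid at every index. *)
Definition offdiag n : R := if n is 0%N then 0 else a n.
Definition shifted_diag n : R := if n is 0%N then 0 else b n - E0.

Lemma offdiag_bound n : `|offdiag n| <= C + `|E0|.
Proof.
have C0 : 0 <= C by apply: le_trans (abC (n := 1) _).
by case: n => [|n]; rewrite /= ?normr0 ?addr_ge0 // (le_trans _ (ler_wpDr _ (abC (n := n.+1) _))) // lerDl.
Qed.

Lemma shifted_diag_bound n : `|shifted_diag n| <= C + `|E0|.
Proof.
have C0 : 0 <= C by apply: le_trans (abC (n := 1) _).
case: n => [|n]; rewrite /= ?normr0 ?addr_ge0 //.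
apply: le_trans (ler_normB _ _) _; rewrite lerD2r.
by apply: le_trans (abC (n := n.+1) _); rewrite // lerDr.
Qed.

(** The matrix is real and symmetric, so the real and imaginary parts of [u] decouple; all series
    converge and the summands agree term by term. *)
Lemma inner_jacobi u : ell2 u ->
  complex.Re (inner u (jacobi a b u)) - E0 * complex.Re (inner u u) =
  tri_form offdiag shifted_diag (re u) + tri_form offdiag shifted_diag (im u).
Proof.
move=> /ell2P[u0 re2 im2].
have cre := is_cvg_tri_form offdiag_bound shifted_diag_bound re2.
have cim := is_cvg_tri_form offdiag_bound shifted_diag_bound im2.
have csq := is_cvg_seriesD re2 im2.
rewrite Re_innerE /tri_form -lim_seriesD // -[E0 * _]/(E0 *: _) -lim_seriesZ //.
apply/eqP; rewrite subr_eq -lim_seriesD; last 2 first.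
- exact: is_cvg_seriesD.
- exact: is_cvg_seriesZ.
apply/eqP; congr (limn (series _)); apply/funext => k.
rewrite -[RHS]/(re u k * tri offdiag shifted_diag (re u) k
  + im u k * tri offdiag shifted_diag (im u) k + E0 * (re u k ^+ 2 + im u k ^+ 2)).
case: k => [|k]; first by rewrite /re /im u0 /=; ring.
rewrite /tri /re /im /= /jacobi.
(* In row 1 the term with [a 0] disappears from [jacobi] because [u 0 = 0], and from [tri] because
   [offdiag] is 0 at 0. *)
case: k => [|k] /=; rewrite ?u0.
  by case: (u 1%N) (u 2%N) => [x y] [x' y'] /=; ring.
by case: (u k.+1) (u k.+2) (u k.+3) => [x0 y0] [x y] [x' y'] /=; ring.
Qed.
End JacobiForm.

(** * The form on the kernel and on the range of a half-line projection *)

Section SpectralForm.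
Variables (R : realType) (T : operator R) (P : set R -> operator R).
Hypothesis hP : spectral_measure_of T P.
Variables (s E0 : R).
Let I := halfline s E0.

Let form u := complex.Re (inner u (T u)) - E0 * complex.Re (inner u u).

Lemma spectral_measure_exists u : ell2 u ->
  exists mu : {measure set (measurableTypeR R) -> \bar R},
  [/\ mu.-integrable setT (fun x : measurableTypeR R => (x : R)%:E),
      mu setT = (complex.Re (inner u u))%:E,
      forall A, measurable A -> mu A = (complex.Re (inner u (P A u)))%:E &
      form u = \int[mu]_x (x : R) - E0 * complex.Re (inner u u)].
Proof.
move=> u2; have [[_ _ PT _ Pmu] Tmu] := hP.
have [mu muP] := Pmu u u2; have [mu_id Tu] := Tmu u mu u2 muP.
exists mu; split=> //; first by rewrite (muP _ measurableT) PT.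
by rewrite /form Tu.
Qed.

Lemma spectral_form_le0 u : ell2 u -> P I u = (fun=> 0) -> s * form u <= 0.
Proof.
move=> u2 PIu; have [mu [mu_id muT muE ->]] := spectral_measure_exists u2.
apply: moment_le0 => //; rewrite muE; last exact: measurable_halfline.
by rewrite PIu inner_0.
Qed.

Lemma spectral_form_gt0 u k : ell2 u -> P I u = u -> u k != 0 -> 0 < s * form u.
Proof.
move=> u2 PIu uk; have [mu [mu_id muT muE ->]] := spectral_measure_exists u2.
have mI := measurable_halfline s E0; have mCI := measurableC mI.
have [[_ P0 _ Pcap _] _] := hP.
apply: moment_gt0 => //; last exact: Re_inner_gt0 uk.
(* The complement of [I] is null for the scalar measure: P(~I) u = P(~I) P(I) u = P(set0) u = 0. *)
by rewrite muE // -[in P _ u]PIu -Pcap // setICl P0 // inner_0.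
Qed.
End SpectralForm.

(** * Dimension of the range, for an admissible sign sequence *)

Section Sturm.
Variables (R : realType) (a b eps : nat -> R) (C E0 s : R).
Hypothesis ha : forall n, (0 < n)%N -> a n != 0.
Hypothesis abC : forall n, (0 < n)%N -> `|a n| + `|b n| <= C.
Variable P : set R -> operator R.
Hypothesis hP : spectral_measure_of (jacobi a b) P.
Let p n := (jacobi_p a b n).[E0].
Hypothesis eps2 : forall n, eps n ^+ 2 = 1.
Hypothesis epsN : forall n, p n.+1 = 0 -> eps n.+2 = - eps n.+1.
Hypothesis eps_gt0 : forall n, p n != 0 -> p n.+1 != 0 ->
  0 < eps n.+1 * - (a n.+1 * p n.+1 * p n).

Let al := offdiag a.
Let be := shifted_diag b E0.
Let D := diag_form al be p eps.
(** The complex-linear extension of the real functional [D l]. *)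
Let Dc l (u : nat -> R[i]) : R[i] := (D l (re u) +i* D l (im u))%C.
Let RanI := Ran (P (halfline s E0)).
Let Pos := [set l : nat | (0 < l)%N /\ 0 < s * eps l].

Let al0 : al 0%N = 0. Proof. by []. Qed.
Let alS n : al n.+1 != 0. Proof. exact: ha. Qed.
Let p0 : p 0%N = 1. Proof. by rewrite /p /= hornerC. Qed.

Lemma jacobi_p_horner n : al n.+1 * p n.+1 + be n.+1 * p n + al n * p n.-1 = 0.
Proof.
have := congr1 (fun q => q.[E0]) (@jacobi_p_rec R a b n (ha (ltn0Sn n))).
rewrite horner0 !hornerE => <-.
by case: n => [|n]; rewrite /p /= ?hornerE ?mul0r.
Qed.

Lemma Dc_sum (T : Type) (r : seq T) l (c : T -> R[i]) (v : T -> nat -> R[i]) :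
  Dc l (fun k => \sum_(i <- r) c i * v i k) = \sum_(i <- r) c i * Dc l (v i).
Proof.
elim: r => [|i r IHr].
  rewrite big_nil; under eq_fun do rewrite big_nil.
  by rewrite /Dc /re /im /= /D diag_form0.
rewrite big_cons -IHr; under eq_fun do rewrite big_cons.
set w := fun k => \sum_(i <- r) _.
rewrite /Dc (funext (re_lin _ _ w)) (funext (im_lin _ _ w)).
rewrite /D !diag_form_lin /Dc.
by apply/eqP; rewrite eq_complex; case: (c i) => x y /=; rewrite mulNr !eqxx.
Qed.

Lemma Ran_sum (n : nat) (c : 'I_n -> R[i]) (v : 'I_n -> nat -> R[i]) :
  (forall i, RanI (v i)) ->
  let u k := \sum_(i < n) c i * v i k in ell2 u /\ P (halfline s E0) u = u.
Proof.
move=> vS u; have [[Pproj _ _ _ _] _] := hP.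
have projI := Pproj _ (measurable_halfline s E0); have [P2 _ Pid _] := projI.
have v2 i : ell2 (v i) by have [w w2 <-] := vS i; exact: P2.
split; first exact: ell2_sum.
rewrite projection_sum //.
by apply/funext => k; apply: eq_bigr => i _; have [w w2 <-] := vS i; rewrite Pid.
Qed.

(** The independent vectors are the projections of the dual vectors of index in [F]. A relation
    between them gives a combination of dual vectors killed by the projection, on which the form has
    both signs; so that combination is 0. *)
Lemma dim_Ran_lower (F : {fset nat}) : [set` F] `<=` Pos ->
  exists2 v : 'I_(#|` F|) -> nat -> R[i], (forall i, RanI (v i)) & lin_indep v.
Proof.
move=> FP; have [[Pproj _ _ _ _] _] := hP.
have projI := Pproj _ (measurable_halfline s E0).
pose l_ (i : 'I_(#|` F|)) := nth 0%N F i.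
have lF i : l_ i \in F by exact: mem_nth.
have l_inj : injective l_.
  by move=> i j /eqP; rewrite nth_uniq ?fset_uniq // => /eqP/val_inj.
pose K := (\max_(l <- F) l)%N.
have FK l : l \in F -> (l <= K)%N by move=> lF'; exact: leq_bigmax_seq.
have [N pN KN] : exists2 N, p N != 0 & (K <= N)%N.
  have [/(p_consecutive alS p0 jacobi_p_horner) pN|pN] := eqVneq (p K) 0.
    by exists K.+1.
  by exists K.
have [f fP] := dual_basis alS p0 jacobi_p_horner eps2 epsN pN.
have lN i : (0 < l_ i <= N)%N.
  by have [-> _] := FP _ (lF i); rewrite (leq_trans (FK _ (lF i))).
pose w i k : R[i] := (f (l_ i) k)%:C%C.
have w2 i : ell2 (w i).
  have [f0 fN _] := fP _ (lN i); apply/ell2P; split; first by rewrite /w f0.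
  - by apply: (l2_finite_support (N := N)) => k /fN; rewrite /re /w.
  - exact: (l2_finite_support (N := N)).
exists (fun i => P (halfline s E0) (w i)) => [i|c cP]; first by exists (w i).
pose u k := \sum_i c i * w i k.
have u2 : ell2 u by exact: ell2_sum.
(* By duality the functionals read off the coefficients [c], and vanish on [u] for indices outside
   [F]. *)
have Du m : (0 < m <= N)%N -> Dc m u = \sum_i c i * (m == l_ i)%:R.
  move=> mN; rewrite /u Dc_sum; apply: eq_bigr => i _; congr (_ * _).
  have [_ _ /(_ m mN) fm] := fP _ (lN i).
  have im0 : D m (im (w i)) = 0 by exact: diag_form0.
  rewrite /Dc im0 (_ : D m (re (w i)) = (m == l_ i)%:R) //.
  by case: (m == l_ i).
have PIu : P (halfline s E0) u = (fun=> 0).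
  by rewrite /u projection_sum //; apply/funext => k; exact: cP.
have [u0 _ _] := (ell2P u).1 u2.
have uN k : (N < k)%N -> u k = 0.
  move=> Nk; apply: big1 => i _; have [_ fN _] := fP _ (lN i).
  by rewrite /w fN // mulr0.
have Dneg l : (0 < l)%N -> ~~ (0 < s * eps l) -> (l <= N)%N -> Dc l u = 0.
  move=> l0 sl lN'; rewrite Du ?l0 //; apply: big1 => i _.
  have [_ sli] := FP _ (lF i).
  by case: eqP => [ll|_]; [rewrite ll sli in sl | rewrite mulr0].
have ge0 := tri_form_ge0 al0 alS p0 jacobi_p_horner eps2 epsN eps_gt0 pN.
have [re_ge0 re_eq0] : 0 <= s * tri_form al be (re u) /\
    (s * tri_form al be (re u) <= 0 -> forall k, re u k = 0).
  apply: ge0 => [|k /uN uk|l l0 sl lN']; rewrite /re ?u0 ?uk //.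
  by have [] := Dneg l l0 sl lN'.
have [im_ge0 im_eq0] : 0 <= s * tri_form al be (im u) /\
    (s * tri_form al be (im u) <= 0 -> forall k, im u k = 0).
  apply: ge0 => [|k /uN uk|l l0 sl lN']; rewrite /im ?u0 ?uk //.
  by have [] := Dneg l l0 sl lN'.
have := spectral_form_le0 hP u2 PIu; rewrite (inner_jacobi _ abC) // mulrDr => sum_le0.
have {}re_eq0 : forall k, re u k = 0 by apply: re_eq0; lra.
have {}im_eq0 : forall k, im u k = 0 by apply: im_eq0; lra.
move=> i; have := Du _ (lN i).
rewrite (bigD1 i) //= eqxx mulr1 big1 => [|j ji]; last first.
  by rewrite (inj_eq l_inj) eq_sym (negPf ji) mulr0.
rewrite addr0 => <-; rewrite /Dc (funext re_eq0) (funext im_eq0).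
by rewrite /D diag_form0.
Qed.

Lemma dim_Ran_upper (F : {fset nat}) : Pos = [set` F] ->
  forall n (v : 'I_n -> nat -> R[i]),
     (forall i, RanI (v i)) -> lin_indep v -> (n <= #|` F|)%N.
Proof.
move=> PF n v vS vI; rewrite leqNgt; apply/negP => Fn.
pose M : 'M[R[i]]_(n, #|` F|) := \matrix_(i, j) Dc (nth 0%N F j) (v i).
(* A matrix with more rows than columns has a nonzero left kernel. *)
have : kermx M != 0.
  rewrite kermx_eq0 /row_free neq_ltn (leq_ltn_trans (rank_leq_col M)) //.
case/rowV0Pn => x /sub_kermxP xM x0.
have [u2 PIu] := Ran_sum (fun i => x ord0 i) vS.
set u := fun k => _ in u2 PIu.
have [k uk] : exists k, u k != 0.
  apply: contrapT => /forallNP u0; case/eqP: x0; apply/rowP => i; rewrite mxE.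
  by apply: (vI (fun i => x ord0 i)) => k; apply/eqP/negPn/negP/u0.
have Du l : (0 < l)%N -> 0 < s * eps l -> Dc l u = 0.
  move=> l0 sl; have lF : l \in F by have : [set` F] l by rewrite -PF.
  have lt_iF : (index l F < #|` F|)%N by rewrite index_mem.
  have := congr1 (fun B : 'rV_ _ => B ord0 (Ordinal lt_iF)) xM.
  rewrite !mxE => E; rewrite /u Dc_sum -[RHS]E; apply: eq_bigr => i _.
  by rewrite mxE /= nth_index.
have epsK l : (0 < l)%N -> 0 < s * eps l -> (l <= \max_(j <- F) j)%N.
  by move=> l0 sl; apply: leq_bigmax_seq => //; have : [set` F] l by rewrite -PF.
have [u0 reu imu] := (ell2P u).1 u2.
have := spectral_form_gt0 hP u2 PIu uk; rewrite (inner_jacobi _ abC) // ltNge => /negP; apply.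
have le0 := tri_form_le0 al0 alS p0 jacobi_p_horner eps2 epsN eps_gt0
  (offdiag_bound E0 abC) (shifted_diag_bound E0 abC) _ _ epsK.
have [] : s * tri_form al be (re u) <= 0 /\ s * tri_form al be (im u) <= 0; last by rewrite mulrDr; lra.
split; apply: le0 => //.
- by rewrite /re u0.
- by move=> l l0 sl; have [] := Du l l0 sl.
- by rewrite /im u0.
- by move=> l l0 sl; have [] := Du l l0 sl.
Qed.

End Sturm.

Lemma dim_Ran_halfline (R : realType) (a b eps : nat -> R) (C E0 s : R)
    (ha : forall n, (0 < n)%N -> a n != 0)
    (abC : forall n, (0 < n)%N -> `|a n| + `|b n| <= C)
    (P : set R -> operator R) (hP : spectral_measure_of (jacobi a b) P)
    (p := fun n => (jacobi_p a b n).[E0])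
    (eps2 : forall n, eps n ^+ 2 = 1)
    (epsN : forall n, p n.+1 = 0 -> eps n.+2 = - eps n.+1)
    (eps_gt0 : forall n, p n != 0 -> p n.+1 != 0 ->
       0 < eps n.+1 * - (a n.+1 * p n.+1 * p n)) :
  ell2_dim (Ran (P (halfline s E0))) =
  counting [set l : nat | (0 < l)%N /\ 0 < s * eps l].
Proof.
apply: ell2_dim_counting => F FP; first exact: (dim_Ran_lower ha abC hP eps2 epsN eps_gt0 FP).
exact: (dim_Ran_upper ha abC hP eps2 epsN eps_gt0 FP).
Qed.

(** * The sign sequence read off from P_n(E0) *)

Section SignChanges.
Variables (R : realType) (a b : nat -> R) (E0 : R).
Hypothesis ha : forall n, (0 < n)%N -> a n != 0.
Let p n := (jacobi_p a b n).[E0].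
Let Q n := (jacobi_P a b n).[E0].

Definition sign_change l : R :=
  if sgn (jacobi_P a b l.-1).[E0] == sgn (jacobi_P a b l).[E0] then -1 else 1.

Lemma sign_change_sqr l : sign_change l ^+ 2 = 1.
Proof. by rewrite /sign_change; case: ifP => _; rewrite ?sqrrN expr1n. Qed.

Let prod_neq0 n : \prod_(1 <= k < n.+1) a k != 0.
Proof. by rewrite big_nat prodf_seq_neq0; apply/allP => k _; apply/implyP => /andP[/ha]. Qed.

Let QE n : Q n = \prod_(1 <= k < n.+1) a k * p n.
Proof. by rewrite /Q /jacobi_P hornerZ. Qed.

Lemma sgn_eq (x y : R) : x != 0 -> y != 0 -> (sgn x == sgn y) = (0 < x * y).
Proof.
rewrite /sgn !neq_lt => /orP[x0|x0] /orP[y0|y0];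
  rewrite ?(ltW x0) ?(ltW y0) ?(ltW x0, ltW y0) ?[0 <= x]leNgt ?[0 <= y]leNgt ?x0 ?y0 /= ?eqxx.
- by rewrite nmulr_rgt0.
- by rewrite nmulr_rgt0 // ltNge (ltW y0) eq_sym; apply/negbTE; lra.
- by rewrite pmulr_rgt0 // ltNge (ltW y0); apply/negbTE; lra.
- by rewrite pmulr_rgt0.
Qed.

(** With c = a_1 ... a_n, the product P_n P_{n+1} is c^2 a_{n+1} p_n p_{n+1}, so passing to monic
    polynomials keeps the relevant sign. *)
Lemma sign_change_gt0 n : p n != 0 -> p n.+1 != 0 ->
  0 < sign_change n.+1 * - (a n.+1 * p n.+1 * p n).
Proof.
move=> pn pn1; have an1 := ha (ltn0Sn n); have prodn := prod_neq0 n.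
rewrite /sign_change /= -/(Q n) -/(Q n.+1) sgn_eq ?QE ?mulf_neq0 //.
rewrite (big_nat_recr n.+1) //=; set c := \prod_(_ <= _ < _) _ in prodn *.
have -> : c * p n * (c * a n.+1 * p n.+1) = c ^+ 2 * (a n.+1 * p n.+1 * p n) by ring.
have c2 : 0 < c ^+ 2 by rewrite exprn_even_gt0.
rewrite (pmulr_rgt0 _ c2); case: ifPn => [|]; first by rewrite mulrNN mul1r.
by rewrite -leNgt mul1r oppr_gt0 lt_neqAle => ->; rewrite !mulf_neq0.
Qed.

(** At a zero of P_{n+1} the recurrence gives P_{n+2} = - a_{n+1}^2 P_n, with P_n nonzero. As sgn(0)
    = 1, exactly one of the two steps through the zero is a sign change. *)
Lemma sign_changeN n : p n.+1 = 0 -> sign_change n.+2 = - sign_change n.+1.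
Proof.
move=> pn1; have rec := jacobi_p_horner b E0 ha; have an1 := ha (ltn0Sn n).
have pn : p n != 0.
  apply: contra_eq_neq pn1; apply: (p_consecutive _ _ rec) => [k|]; first exact: ha.
  by rewrite /= hornerC.
have Qn : Q n != 0 by rewrite QE mulf_neq0 ?prod_neq0.
have Qn1 : Q n.+1 = 0 by rewrite QE pn1 mulr0.
have Qn2 : Q n.+2 = - (a n.+1 ^+ 2 * Q n).
  rewrite !QE (big_nat_recr n.+2) // (big_nat_recr n.+1) //=.
  have := rec n.+1; rewrite /= -/(p n) -/(p n.+1) -/(p n.+2) pn1 mulr0 addr0.
  move/eqP; rewrite addr_eq0 => /eqP E; rewrite -mulrA E; ring.
rewrite /sign_change /= -/(Q n) -/(Q n.+1) -/(Q n.+2) Qn2 Qn1 /sgn lexx.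
have a2 : 0 < a n.+1 ^+ 2 by rewrite exprn_even_gt0.
have -> : (0 <= - (a n.+1 ^+ 2 * Q n)) = (Q n <= 0) by rewrite oppr_ge0 pmulr_rle0.
have N11 : (-1 == 1 :> R) = false by apply/negbTE; lra.
by move: Qn; rewrite neq_lt => /orP[Q0|Q0]; rewrite (ltW Q0) leNgt Q0 /= ?eqxx ?(eq_sym 1) N11 ?opprK.
Qed.
End SignChanges.

(** * The two half-lines *)

Unset Implicit Arguments.
Set Strict Implicit.
Set Printing Implicit Defensive.

Theorem theorem2p5 (R : realType) (a b : nat -> R)
    (ha : forall n, (0 < n)%N -> a n != 0)
    (hab : has_ubound ([set `|a n| + `|b n| | n in [set n | (0 < n)%N]] : set R))
    (P : set R -> operator R) (hP : spectral_measure_of (jacobi a b) P)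
    (E0 : R) :
  ell2_dim (Ran (P `]E0, +oo[%classic)) =
    counting [set l : nat | (0 < l)%N /\
      sgn (jacobi_P a b l.-1).[E0] <> sgn (jacobi_P a b l).[E0]] /\
  ell2_dim (Ran (P `]-oo, E0[%classic)) =
    counting [set l : nat | (0 < l)%N /\
      sgn (jacobi_P a b l.-1).[E0] = sgn (jacobi_P a b l).[E0]].
Proof.
have [C abC'] := hab.
have abC n : (0 < n)%N -> `|a n| + `|b n| <= C by move=> n0; apply: abC'; exists n.
(* The same signs serve both values of [s]: [s = 1] selects the sign changes and [s = -1] the other
   indices. *)
have dimE s := dim_Ran_halfline s ha abC hP (sign_change_sqr a b E0)
  (sign_changeN ha) (sign_change_gt0 ha).
split.
- have -> : `]E0, +oo[%classic = halfline 1 E0.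
    by apply/seteqP; split => x; rewrite /halfline /= in_itv /= andbT mul1r subr_gt0.
  rewrite dimE; congr counting; apply/seteqP; split => l /= [l0] h; split=> //.
    by move=> E; move: h; rewrite /sign_change E eqxx; lra.
  by rewrite mul1r /sign_change; case: eqP.
- have -> : `]-oo, E0[%classic = halfline (-1) E0.
    by apply/seteqP; split => x; rewrite /halfline /= in_itv /= mulN1r opprB subr_gt0.
  rewrite dimE; congr counting; apply/seteqP; split => l /= [l0] h; split=> //.
    by move: h; rewrite /sign_change; case: eqP => // _; lra.
  by rewrite mulN1r /sign_change h eqxx opprK.
Qed.
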